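(* Let $\mathcal L$ be a centerless Lie $\Lambda$-torus, let $D=\bigoplus_{\mu\in\Gamma}D^\mu$ be a permissible subalgebra of $\mathrm{SCDer}(\mathcal L)$, let $\kappa:D\times D\to D^{gr\star}$ be an affine cocycle on $D$, and let $\tau$ be a pre-Chevalley involution of $\mathcal L$. Put $D_\tau=\{\tau d\tau^{-1}:d\in D\}$ and define $\kappa_\tau:D_\tau\times D_\tau\to D_\tau^{gr\star}$ by $\kappa_\tau(\bar\tau(d),\bar\tau(d'))=\bar\tau(\kappa(d,d'))$ for $d,d'\in D$, where $\bar\tau(d)=\tau d\tau^{-1}$ for $d\in D$ and $\bar\tau(\varphi)(e)=\varphi(\tau^{-1}e\tau)$ for $\varphi\in D^{gr\star}$, $e\in D_\tau$. Then: (i) $D_\tau$ is a permissible subalgebra of $\mathrm{SCDer}(\mathcal L)$. (ii) The map $\kappa_\tau$ is an affine cocycle on $D_\tau$.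
   Context: Everything is over the field $\mathbb K=\mathbb C$. **Lie tori.** $\Lambda$ is a free abelian group of finite rank; $\Delta$ is a finite irreducible root system (containing $0$), $\Delta^\times=\Delta\setminus\{0\}$, $Q=\mathrm{span}_{\mathbb Z}\Delta$, $\Delta_{\mathrm{ind}}=\{0\}\cup\{\alpha\in\Delta^\times:\alpha/2\notin\Delta\}$, and $\langle\beta,\alpha^\vee\rangle$ are the Cartan integers. A Lie $\Lambda$-torus of type $\Delta$ is a Lie algebra $\mathcal L=\bigoplus_{(\alpha,\lambda)\in Q\times\Lambda}\mathcal L_\alpha^\lambda$, graded by $Q\times\Lambda$, such that: (LT1) $\mathcal L_\alpha^\lambda=0$ if $\alpha\notin\Delta$; (LT2) for $\alpha\in\Delta^\times$, $\lambda\in\Lambda$: $\dim\mathcal L_\alpha^\lambda\le1$, with $\dim\mathcal L_\alpha^0=1$ if $\alpha\in\Delta_{\mathrm{ind}}$; and if $\dim\mathcal L_\alpha^\lambda=1$ there are $e_\alpha^\lambda,f_\alpha^\lambda$ with $\mathcal L_\alpha^\lambda=\mathbb K e_\alpha^\lambda$, $\mathcal L_{-\alpha}^{-\lambda}=\mathbb K f_\alpha^\lambda$ and $[[e_\alpha^\lambda,f_\alpha^\lambda],x]=\langle\beta,\alpha^\vee\rangle x$ for all $x\in\mathcal L_\beta^\mu$, $\beta\in\Delta$, $\mu\in\Lambda$; (LT3) $\mathcal L_0^\lambda=\sum_{\alpha\in\Delta^\times,\mu\in\Lambda}[\mathcal L_\alpha^\mu,\mathcal L_{-\alpha}^{\lambda-\mu}]$;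 (LT4) $\Lambda$ is generated by $\{\lambda:\mathcal L_\alpha^\lambda\ne0\text{ for some }\alpha\in\Delta\}$. Put $\mathcal L^\lambda=\bigoplus_\alpha\mathcal L_\alpha^\lambda$. $\mathcal L$ is centerless if its center is $0$. A pre-Chevalley involution of $\mathcal L$ is a Lie algebra automorphism $\tau$ of order $2$ with $\tau(\mathcal L^\lambda)=\mathcal L^{-\lambda}$ for all $\lambda\in\Lambda$. **Skew centroidal derivations.** Let $\mathcal L$ be centerless. Its centroid is $\mathrm{Cent}(\mathcal L)=\bigoplus_{\mu\in\Gamma}\mathbb K\chi^\mu$, where $\Gamma\le\Lambda$ is a subgroup, $\chi^\mu$ has degree $\mu$ and $\chi^\mu\chi^\nu=\chi^{\mu+\nu}$. For $\theta\in\mathrm{Hom}_{\mathbb Z}(\Lambda,\mathbb K)$ let $\partial_\theta$ be the derivation $\partial_\theta(x)=\theta(\lambda)x$, $x\in\mathcal L^\lambda$. Put $\mathrm{SCDer}(\mathcal L)=\bigoplus_{\mu\in\Gamma}\mathrm{SCDer}(\mathcal L)^\mu$, $\mathrm{SCDer}(\mathcal L)^\mu=\{\chi^\mu\partial_\theta:\theta\in\mathrm{Hom}_{\mathbb Z}(\Lambda,\mathbb K),\ \theta(\mu)=0\}$, a $\Gamma$-graded Lie algebra under the commutator. A subalgebra $D$ of $\mathrm{SCDer}(\mathcal L)$ is permissible if it is $\Gamma$-graded, $D=\bigoplus_{\mu\in\Gamma}D^\mu$ with $D^\mu=D\cap\mathrm{SCDer}(\mathcal L)^\mu$, and the evaluation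 map $\mathrm{ev}:\Lambda\to(D^0)^\star$, $\mathrm{ev}(\lambda)(\partial_\theta)=\theta(\lambda)$, is injective with discrete image. The graded dual $D^{gr\star}=\bigoplus_\mu(D^\mu)^\star$ (elements of $(D^\mu)^\star$ extended by $0$ to the other $D^\nu$) is a $D$-module via $(d\cdot\varphi)(d')=\varphi([d',d])$. An affine cocycle on $D$ is a bilinear map $\kappa:D\times D\to D^{gr\star}$ such that, for all $d,d_1,d_2,d_3\in D$ and $\mu_1,\mu_2\in\Gamma$: $\kappa(d,d)=0$; $\sum\kappa([d_i,d_j],d_k)=\sum d_i\cdot\kappa(d_j,d_k)$ (sums over cyclic permutations $(i,j,k)$ of $(1,2,3)$); $\kappa(D^{\mu_1},D^{\mu_2})\subseteq(D^{-\mu_1-\mu_2})^\star$; $\kappa(d_1,d_2)(d_3)=\kappa(d_2,d_3)(d_1)$; $\kappa(D^0,D)=0$. *)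

(* Defs.v *)
From HB Require Import structures.
From mathcomp Require Import all_boot all_order all_algebra.
From mathcomp Require Import complex.
From mathcomp Require Import all_classical all_reals topology.
From mathcomp Require Import normedtype.

Set Implicit Arguments.
Unset Strict Implicit.
Unset Printing Implicit Defensive.

Import Order.TTheory GRing.Theory Num.Theory.
Import numFieldNormedType.Exports.

Local Open Scope classical_set_scope.
Local Open Scope ring_scope.

(** * Linear algebra with subspaces represented by classical sets *)

Section LinearAlgebra.
Variables (K : fieldType) (E : lmodType K).

Definition subspace_pred (W : set E) : Prop := submod_closed [in W].

Definition lin_span (X : set E) : set E := smallest subspace_pred X.

Definition line (x : E) : set E := range (fun a : K => a *: x).

Definition dim_le1 (W : set E) : Prop := exists x, W `<=` line x.

Definition dim_eq1 (W : set E) : Prop := exists2 x, x != 0 & W = line x.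

(* W is the internal direct sum of the subspaces A i, for i in S. *)
Definition direct_sum (I : eqType) (S : set I) (A : I -> set E) (W : set E) :
    Prop :=
  [/\ forall i, S i -> subspace_pred (A i),
      W = lin_span (\bigcup_(i in S) A i)
    & forall (s : seq I) (x : I -> E), uniq s ->
        (forall i, i \in s -> S i /\ A i (x i)) ->
        \sum_(i <- s) x i = 0 -> forall i, i \in s -> x i = 0].

End LinearAlgebra.

Definition subgroup_pred (V : zmodType) (A : set V) : Prop :=
  zmod_closed [in A].

Definition subgroup_span (V : zmodType) (X : set V) : set V :=
  smallest (@subgroup_pred V) X.

Definition free_of_finite_rank (Lambda : zmodType) : Prop :=
  exists (n : nat) (f : {additive Lambda -> 'rV[int]_n}), bijective f.

(** * Root systems *)

Section RootSystems.
Variables (K : fieldType) (V : vectType K).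
(* [coroot alpha beta] is <beta, alpha^vee>; only its values at nonzero roots
   alpha matter, and there the axioms below determine it in characteristic 0. *)
Variables (Delta : seq V) (coroot : V -> {scalar V}).

Definition nz_root (alpha : V) : Prop := alpha \in Delta /\ alpha != 0.

(* The root system is Delta minus 0; it need not be reduced. *)
Record irreducible_root_system : Prop := {
  root_zero : 0 \in Delta;
  root_span : <<Delta>>%VS = fullv;
  coroot_self : forall alpha, nz_root alpha -> coroot alpha alpha = 2;
  root_reflection : forall alpha beta, nz_root alpha -> beta \in Delta ->
    beta - coroot alpha beta *: alpha \in Delta;
  coroot_int : forall alpha beta, nz_root alpha -> beta \in Delta ->
    exists m : int, coroot alpha beta = m%:~R;
  root_nonempty : exists alpha, nz_root alpha;
  root_irreducible : forall A B : set V,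
    A !=set0 -> B !=set0 -> A `&` B = set0 -> nz_root = A `|` B ->
    exists alpha beta, [/\ A alpha, B beta & coroot alpha beta != 0]
}.

Definition indivisible (alpha : V) : Prop :=
  alpha = 0 \/ nz_root alpha /\ 2^-1 *: alpha \notin Delta.

Definition root_lattice : set V := subgroup_span [set` Delta].

End RootSystems.

(** * Lie algebras *)

HB.mixin Record Lmodule_isLieAlgebra (K : fieldType) L of GRing.Lmodule K L := {
  lie : L -> L -> L;
  lie_linearl : forall y : L, linear (lie^~ y);
  lie_linearr : forall x : L, linear (lie x);
  liexx : forall x : L, lie x x = 0;
  lie_jacobi : forall x y z : L,
    lie x (lie y z) + lie y (lie z x) + lie z (lie x y) = 0
}.

#[short(type="lieAlgType")]
HB.structure Definition LieAlgebra (K : fieldType) :=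
  { L of Lmodule_isLieAlgebra K L & GRing.Lmodule K L }.

Section LieAlgebras.
Variables (K : fieldType) (L : lieAlgType K).

Definition centerless : Prop :=
  forall x : L, (forall y : L, lie x y = 0) -> x = 0.

Definition commutator (f g : L -> L) : L -> L := (f \o g) - (g \o f).

Definition centroid : set (L -> L) :=
  [set f | linear f /\
     forall x y, f (lie x y) = lie (f x) y /\ f (lie x y) = lie x (f y)].

Definition lie_automorphism (tau : L -> L) : Prop :=
  [/\ linear tau, bijective tau
    & forall x y, tau (lie x y) = lie (tau x) (tau y)].

End LieAlgebras.

(** * Lie tori *)

Section LieTori.
Variables (K : fieldType) (Lambda : zmodType) (V : vectType K).
Variables (Delta : seq V) (coroot : V -> {scalar V}) (L : lieAlgType K).
(* [G alpha lambda] is the component of degree (alpha, lambda); only its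
   values for alpha in the root lattice Q are meaningful. *)
Variable G : V -> Lambda -> set L.

Let Q := root_lattice Delta.

Record is_lie_torus : Prop := {
  torus_sum : direct_sum [set i : V * Lambda | Q i.1]
    (fun i => G i.1 i.2) [set: L];
  torus_lie : forall alpha beta lambda mu x y, Q alpha -> Q beta ->
    G alpha lambda x -> G beta mu y ->
    G (alpha + beta) (lambda + mu) (lie x y);
  LT1 : forall alpha lambda, Q alpha -> alpha \notin Delta ->
    G alpha lambda = [set 0];
  LT2_dim : forall alpha lambda, nz_root Delta alpha ->
    dim_le1 (G alpha lambda);
  LT2_ind : forall alpha, nz_root Delta alpha -> indivisible Delta alpha ->
    dim_eq1 (G alpha 0);
  LT2_sl2 : forall alpha lambda, nz_root Delta alpha ->
    dim_eq1 (G alpha lambda) ->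
    exists e f : L, [/\ G alpha lambda = line e,
      G (- alpha) (- lambda) = line f
      & forall beta mu x, beta \in Delta -> G beta mu x ->
          lie (lie e f) x = coroot alpha beta *: x];
  LT3 : forall lambda, G 0 lambda = lin_span
    [set z | exists alpha mu x y, [/\ nz_root Delta alpha, G alpha mu x,
       G (- alpha) (lambda - mu) y & z = lie x y]];
  LT4 : subgroup_span [set lambda | exists2 alpha, alpha \in Delta
          & G alpha lambda <> [set 0]] = [set: Lambda]
}.

Definition ext_component (lambda : Lambda) : set L :=
  lin_span (\bigcup_(alpha in Q) G alpha lambda).

End LieTori.

(** * Skew centroidal derivations

    Here [A lambda] stands for the component of degree lambda of L. *)

Section SkewCentroidalDerivations.
Variables (K : fieldType) (Lambda : zmodType) (L : lieAlgType K).
Variable A : Lambda -> set L.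

Record centroid_basis (Gamma : set Lambda) (chi : Lambda -> L -> L) : Prop := {
  centroid_degrees : subgroup_pred Gamma;
  centroid_neq0 : forall mu, Gamma mu -> chi mu <> 0;
  centroid_sum : direct_sum Gamma (fun mu => line (chi mu)) (@centroid K L);
  centroid_degree : forall mu lambda x, Gamma mu -> A lambda x ->
    A (lambda + mu) (chi mu x);
  centroid_mul : forall mu nu, Gamma mu -> Gamma nu ->
    chi mu \o chi nu = chi (mu + nu)
}.

(* [degree_derivation theta d] means d = partial_theta: since L is the sum of
   the A lambda, there is exactly one such d. *)
Definition degree_derivation (theta : {additive Lambda -> K}) (d : L -> L) :
    Prop :=
  linear d /\ forall lambda x, A lambda x -> d x = theta lambda *: x.

Variables (Gamma : set Lambda) (chi : Lambda -> L -> L).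

Definition SCDer_component (mu : Lambda) : set (L -> L) :=
  [set f | exists (theta : {additive Lambda -> K}) (d : L -> L),
     [/\ degree_derivation theta d, theta mu = 0 & f = chi mu \o d]].

Definition SCDer : set (L -> L) :=
  lin_span (\bigcup_(mu in Gamma) SCDer_component mu).

End SkewCentroidalDerivations.

(** * Permissible subalgebras and affine cocycles *)

Section Permissible.
Variables (R : realType) (Lambda : zmodType) (L : lieAlgType R[i]).
Variables (A : Lambda -> set L) (Gamma : set Lambda) (chi : Lambda -> L -> L).
Variable D : set (L -> L).

Definition component (mu : Lambda) : set (L -> L) :=
  D `&` SCDer_component A chi mu.

Definition subalgebra_of_SCDer : Prop :=
  [/\ D `<=` SCDer A Gamma chi, subspace_pred D
    & forall d d', D d -> D d' -> D (commutator d d')].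

(* theta is recovered from partial_theta: the latter determines the former
   because the degrees of L generate Lambda. *)
Definition ev_value (lambda : Lambda) (d : L -> L) : R[i] :=
  xget 0 [set c | exists2 theta : {additive Lambda -> R[i]},
                    degree_derivation A theta d & c = theta lambda].

(* The dual of D^0 sits in the space of all functions on D^0 with the topology
   of pointwise convergence; as D^0 is finite dimensional, the induced topology
   is the usual one. The norm topology of the complex field is attached to
   R[i]^o. *)
Definition ev (lambda : Lambda) : {ptws component 0 -> R[i]^o} :=
  fun d => ev_value lambda (val d).

Definition discrete_set (T : topologicalType) (X : set T) : Prop :=
  isolated X = X.

Record permissible : Prop := {
  permissible_subalgebra : subalgebra_of_SCDer;
  permissible_graded : direct_sum Gamma component D;
  permissible_inj : injective ev;
  permissible_discrete : discrete_set (range ev)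
}.

(* Functionals on D are represented by functions on L -> L, of which only the
   restriction to D matters: two of them are equal when they agree on D. *)
Local Notation functional := ((L -> L) -> R[i]).

Definition eq_on_D (phi psi : functional) : Prop :=
  forall d, D d -> phi d = psi d.

Definition linear_on_D (phi : functional) : Prop :=
  forall (a : R[i]) d d', D d -> D d' -> phi (a *: d + d') = a * phi d + phi d'.

(* (D^mu)^*, extended by 0 to the other components *)
Definition dual_component (mu : Lambda) : set functional :=
  [set phi | linear_on_D phi /\
     forall nu d, Gamma nu -> nu != mu -> component nu d -> phi d = 0].

Definition graded_dual : set functional :=
  [set phi | exists (s : seq Lambda) (psi : Lambda -> functional),
     (forall mu, mu \in s -> Gamma mu /\ dual_component mu (psi mu)) /\
     eq_on_D phi (\sum_(mu <- s) psi mu)].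

Definition dual_act (d : L -> L) (phi : functional) : functional :=
  fun d' => phi (commutator d' d).

Record affine_cocycle (kappa : (L -> L) -> (L -> L) -> functional) : Prop := {
  cocycle_val : forall d1 d2, D d1 -> D d2 -> graded_dual (kappa d1 d2);
  cocycle_linearl : forall (a : R[i]) d d' e, D d -> D d' -> D e ->
    eq_on_D (kappa (a *: d + d') e) (fun x => a * kappa d e x + kappa d' e x);
  cocycle_linearr : forall (a : R[i]) d d' e, D d -> D d' -> D e ->
    eq_on_D (kappa e (a *: d + d')) (fun x => a * kappa e d x + kappa e d' x);
  cocycle_alt : forall d, D d -> eq_on_D (kappa d d) 0;
  cocycle_cyc : forall d1 d2 d3, D d1 -> D d2 -> D d3 ->
    eq_on_D
      (kappa (commutator d1 d2) d3 + kappa (commutator d2 d3) d1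
         + kappa (commutator d3 d1) d2)
      (dual_act d1 (kappa d2 d3) + dual_act d2 (kappa d3 d1)
         + dual_act d3 (kappa d1 d2));
  cocycle_degree : forall mu1 mu2 d1 d2, Gamma mu1 -> Gamma mu2 ->
    component mu1 d1 -> component mu2 d2 ->
    dual_component (- mu1 - mu2) (kappa d1 d2);
  cocycle_invariant : forall d1 d2 d3, D d1 -> D d2 -> D d3 ->
    kappa d1 d2 d3 = kappa d2 d3 d1;
  cocycle_0 : forall d1 d2, component 0 d1 -> D d2 -> eq_on_D (kappa d1 d2) 0
}.

End Permissible.

(** * Transport along a pre-Chevalley involution *)

Section Transport.
Variables (R : realType) (L : lieAlgType R[i]) (tau : L -> L).

Definition pre_chevalley_involution (Lambda : zmodType)
    (A : Lambda -> set L) : Prop :=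
  [/\ lie_automorphism tau, tau \o tau = id, tau <> id
    & forall lambda, tau @` A lambda = A (- lambda)].

Definition tau_inv : L -> L := 'pinv_(fun=> 0) [set: L] tau.

Definition bar (d : L -> L) : L -> L := tau \o d \o tau_inv.

Definition bar_inv (e : L -> L) : L -> L := tau_inv \o e \o tau.

Definition bar_dual (phi : (L -> L) -> R[i]) : (L -> L) -> R[i] :=
  fun e => phi (bar_inv e).

Definition D_tau (D : set (L -> L)) : set (L -> L) := bar @` D.

Definition kappa_tau (kappa : (L -> L) -> (L -> L) -> (L -> L) -> R[i]) :
    (L -> L) -> (L -> L) -> (L -> L) -> R[i] :=
  fun e e' => bar_dual (kappa (bar_inv e) (bar_inv e')).

Lemma tau_invK : bijective tau -> cancel tau tau_inv.
Proof.
move=> /bij_inj tau_inj x; rewrite /tau_inv pinvKV ?inE // => y z _ _.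
exact: tau_inj.
Qed.

Lemma bar_invK : bijective tau -> cancel bar bar_inv.
Proof.
move=> /tau_invK tauK d; apply/funext => x.
by rewrite /bar_inv /bar /= !tauK.
Qed.

(* the defining property of kappa_tau *)
Lemma kappa_tauE kappa d d' : bijective tau ->
  kappa_tau kappa (bar d) (bar d') = bar_dual (kappa d d').
Proof. by move=> tau_bij; rewrite /kappa_tau !bar_invK. Qed.

End Transport.

(* Main.v *)
Require Import Defs.
From HB Require Import structures.
From mathcomp Require Import all_boot all_order all_algebra.
From mathcomp Require Import complex.
From mathcomp Require Import all_classical all_reals topology.
From mathcomp Require Import normedtype.

Set Implicit Arguments.
Unset Strict Implicit.
Unset Printing Implicit Defensive.

Import GRing.Theory.
Local Open Scope classical_set_scope.
Local Open Scope ring_scope.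

(** As [tau] is an involution, conjugation by it is an involution [bar] of the
    space of all maps [L -> L] that is linear and preserves composition, hence
    commutators; so [e] lies in [D_tau] exactly when [bar e] lies in [D].  The
    one fact with content is that [bar] reverses degrees in SCDer: it sends the
    component of degree [mu] into that of degree [- mu]
    ([bar_SCDer_component]).

    The map [tau] exchanges the degrees [lambda] and [- lambda] of [L], so
    [bar] sends partial_theta to partial_(- theta).  It also sends chi^mu to an
    element of the centroid that is homogeneous of degree [- mu].  The spaces
    [A lambda] form a direct sum ([direct_sum_ext_component]), so comparing
    degrees in the expansion of such an element on the chi^nu leaves only a
    multiple [c] of chi^(- mu) ([homogeneous_centroid]).  Therefore
    bar (chi^mu partial_theta) = chi^(- mu) partial_(- c theta), and
    [- c theta] still vanishes at [- mu].

    It follows that [bar] matches the components of degrees [mu] of [D] and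
    [- mu] of [D_tau] ([component_D_tau]), whence the grading of [D_tau].
    Moreover the evaluation maps of [D] and [D_tau] correspond under
    precomposition with [bar], up to lambda |-> - lambda; this precomposition is
    continuous, and injectivity and discreteness pull back along it
    ([discrete_set_pullback]).  Each cocycle identity for [kappa_tau] at [e1],
    [e2], ... is the identity for [kappa] at [bar e1], [bar e2], ..., with all
    degrees negated. *)

(** * Spans and direct sums of subspaces *)

Section DirectSums.
Context {K : fieldType} {E : lmodType K}.
Implicit Types (W X : set E).

Lemma subspaceP W : subspace_pred W <->
  W 0 /\ forall (a : K) u v, W u -> W v -> W (a *: u + v).
Proof.
split=> -[W0 WD]; split.
- by rewrite inE in W0.
- by move=> a u v Wu Wv; have := WD a u v; rewrite !inE; exact.
- by rewrite inE.
- by move=> a u v; rewrite !inE; exact: WD.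
Qed.

Lemma subspace0 W : subspace_pred W -> W 0.
Proof. by move=> /subspaceP[]. Qed.

Lemma subspaceZ W (a : K) u : subspace_pred W -> W u -> W (a *: u).
Proof. by move=> /subspaceP[W0 WD] Wu; rewrite -[_ *: _]addr0; exact: WD. Qed.

Lemma subspaceB W u v : subspace_pred W -> W u -> W v -> W (u - v).
Proof.
by move=> /subspaceP[_ WD] Wu Wv; rewrite addrC -scaleN1r; exact: WD.
Qed.

Lemma subspace_lin_span X : subspace_pred (lin_span X).
Proof.
apply/subspaceP; split=> [M [/subspaceP[M0 _] _] //|a u v Xu Xv M CM].
have [/subspaceP[_ MD] _] := CM.
by apply: MD; [exact: Xu | exact: Xv].
Qed.

Lemma lin_span_min X W : subspace_pred W -> X `<=` W -> lin_span X `<=` W.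
Proof. exact: smallest_sub. Qed.

Lemma linear_at0 (F : lmodType K) (f : E -> F) : linear f -> f 0 = 0.
Proof.
by move=> lf; have := lf (-1) 0 0; rewrite scaler0 addr0 scaleN1r addNr.
Qed.

Lemma linear_atZ (F : lmodType K) (f : E -> F) (a : K) u :
  linear f -> f (a *: u) = a *: f u.
Proof. by move=> lf; rewrite -[a *: u]addr0 lf linear_at0 // addr0. Qed.

(** Two linear maps that agree on a spanning set are equal: combine with
    [lin_span_min]. *)
Lemma subspace_linear_eq (F : lmodType K) (f g : E -> F) :
  linear f -> linear g -> subspace_pred [set x | f x = g x].
Proof.
move=> lf lg; apply/subspaceP; split=> [|a u v /= eu ev].
  by rewrite /= !linear_at0.
by rewrite lf lg eu ev.
Qed.

Lemma linear_scale (F : lmodType K) (c : K) (f : E -> F) :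
  linear f -> linear (c *: f).
Proof.
move=> lf a u v; change (c *: f (a *: u + v) = a *: (c *: f u) + c *: f v).
by rewrite lf scalerDr !scalerA mulrC.
Qed.

Lemma sum_extend (I : eqType) (s t : seq I) (y : I -> E) :
  uniq s -> uniq t -> {subset s <= t} -> (forall i, i \notin s -> y i = 0) ->
  \sum_(i <- t) y i = \sum_(i <- s) y i.
Proof.
move=> us ut st y0; rewrite (bigID (mem s)) /= [X in _ + X]big1 // addr0.
rewrite -big_filter; apply: perm_big; apply: uniq_perm => //.
  exact: filter_uniq.
move=> i; rewrite mem_filter andb_idr //; exact: st.
Qed.

(** The family [y] is total, with value 0 off the finite support [s], so that
    decompositions with different supports can be added, and rewritten over a
    common support by [sum_extend]. *)
Lemma lin_span_bigcup (I : eqType) (S : set I) (A : I -> set E) x :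
  (forall i, S i -> subspace_pred (A i)) -> lin_span (\bigcup_(i in S) A i) x ->
  exists (s : seq I) (y : I -> E), [/\ uniq s, forall i, i \in s -> S i,
    forall i, S i -> A i (y i), forall i, i \notin s -> y i = 0
    & x = \sum_(i <- s) y i].
Proof.
move=> subA; move: x.
pose W := [set x | exists (s : seq I) (y : I -> E), [/\ uniq s,
    forall i, i \in s -> S i,
    forall i, S i -> A i (y i), forall i, i \notin s -> y i = 0
    & x = \sum_(i <- s) y i]].
apply: (@lin_span_min _ W); last first.
  move=> x [i Si Aix]; exists [:: i], (fun j => if j == i then x else 0).
  split=> // [j|j Sj|j|].
  - by rewrite inE => /eqP ->.
  - by case: eqP => [->//|_]; exact: subspace0 (subA _ Sj).
  - by rewrite inE => /negbTE ->.
  - by rewrite big_seq1 eqxx.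
apply/subspaceP; split.
  exists [::], (fun=> 0); split=> // [i Si|]; last by rewrite big_nil.
  exact: subspace0 (subA _ Si).
move=> a u v [s [y [us Ss Ay y0 ->]]] [t [z [ut St Az z0 ->]]].
exists (undup (s ++ t)), (fun i => a *: y i + z i); split.
- exact: undup_uniq.
- by move=> i; rewrite mem_undup mem_cat => /orP[/Ss|/St].
- move=> i Si; have /subspaceP[_ WD] := subA _ Si.
  by apply: WD; [exact: Ay | exact: Az].
- move=> i; rewrite mem_undup mem_cat negb_or => /andP[/y0 -> /z0 ->].
  by rewrite scaler0 addr0.
- rewrite big_split -scaler_sumr; congr (_ *: _ + _).
  all: apply/esym/sum_extend => //.
  + exact: undup_uniq.
  + by move=> i si; rewrite mem_undup mem_cat si.
  + exact: undup_uniq.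
  + by move=> i ti; rewrite mem_undup mem_cat ti orbT.
Qed.

(** Images of direct sums under an injective linear map are direct.  Taking [f]
    to be its own inverse turns membership in an image into membership of [f x],
    and [sigma] allows for a map that permutes the summands, as one reversing
    the degrees does. *)
Lemma direct_sum_image (I : eqType) (S : set I) (A B : I -> set E) W
    (f : E -> E) (sigma : I -> I) :
  linear f -> involutive f -> involutive sigma ->
  (forall i, S i -> S (sigma i)) ->
  (forall i, S i -> B i = f @` A (sigma i)) ->
  direct_sum S A W -> direct_sum S B (f @` W).
Proof.
move=> lf fK sK Ss BE [subA WE indA].
pose fM := GRing.isLinear.Build K E E *:%R f lf.
pose fL : {linear E -> E} := HB.pack f fM.
have f0 : f 0 = 0 := linear_at0 lf.
have imP X x : (f @` X) x <-> X (f x).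
  by split=> [[y Xy <-]|Xfx]; [rewrite fK | exists (f x)].
have sub_im X : subspace_pred X -> subspace_pred (f @` X).
  move=> /subspaceP[X0 XD]; apply/subspaceP; split.
    by apply/imP; rewrite f0.
  by move=> a u v /imP Xu /imP Xv; apply/imP; rewrite lf; exact: XD.
split.
- by move=> i Si; rewrite BE //; apply/sub_im/subA/Ss.
- apply/seteqP; split=> [x /imP|].
    rewrite WE => Wfx.
    have : (f @` lin_span (\bigcup_(i in S) B i)) (f x).
      apply: lin_span_min Wfx; first exact/sub_im/subspace_lin_span.
      move=> y [i Si Aiy]; apply/imP; apply: sub_gen_smallest.
      exists (sigma i); first exact: Ss.
      by rewrite BE ?sK; [apply/imP; rewrite fK | exact: Ss].
    by move=> /imP; rewrite fK.
  apply: lin_span_min.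
    by apply: sub_im; rewrite WE; exact: subspace_lin_span.
  move=> y [i Si]; rewrite BE // => /imP Aiy; apply/imP; rewrite WE.
  apply: sub_gen_smallest; exists (sigma i) => //; exact: Ss.
- move=> s x us sx x0 i si.
  (* A relation among the [B j] is carried by [f] to one among the [A j]. *)
  have : f (x (sigma (sigma i))) = 0; last first.
    by rewrite sK => fx0; rewrite -[x i]fK fx0 f0.
  apply: (indA (map sigma s) (fun j => f (x (sigma j)))).
  + by rewrite map_inj_uniq //; exact: inv_inj sK.
  + move=> _ /mapP[j sj ->]; have [Sj Bj] := sx j sj; split; first exact: Ss.
    by rewrite sK; apply/imP; rewrite -BE.
  + transitivity (f (\sum_(j <- s) x j)); last by rewrite x0.
    rewrite big_map [RHS](linear_sum fL).
    by apply: eq_bigr => j _; rewrite sK.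
  + exact: map_f.
Qed.

End DirectSums.

(** * The grading of a Lie torus by external degree *)

(** Grouping the summands of a direct sum, here those of equal second degree,
    gives a direct sum: a relation between finitely many groups is a relation
    between the summands over one finite set [t] of first degrees. *)
Lemma direct_sum_ext_component (K : fieldType) (Lambda : zmodType)
    (V : vectType K) (Delta : seq V) (L : lieAlgType K)
    (G : V -> Lambda -> set L) :
  direct_sum [set i : V * Lambda | root_lattice Delta i.1]
    (fun i => G i.1 i.2) [set: L] ->
  direct_sum [set: Lambda] (ext_component Delta G) [set: L].
Proof.
set Q := root_lattice Delta => -[subG spanG indG]; split.
- by move=> l _; exact: subspace_lin_span.
- apply/seteqP; split=> // x _; have : [set: L] x by [].
  rewrite spanG; apply: lin_span_min; first exact: subspace_lin_span.
  move=> y [[alpha l] /= Qalpha Gy]; apply: sub_gen_smallest.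
  by exists l => //; apply: sub_gen_smallest; exists alpha.
- move=> s x us sx x0.
  have /choice[p pP] : forall l, exists p : seq V * (V -> L), l \in s ->
      [/\ uniq p.1, forall alpha, alpha \in p.1 -> Q alpha,
        forall alpha, Q alpha -> G alpha l (p.2 alpha),
        forall alpha, alpha \notin p.1 -> p.2 alpha = 0
        & x l = \sum_(alpha <- p.1) p.2 alpha].
    move=> l; case: (boolP (l \in s)) => [sl|_]; last by exists ([::], fun=> 0).
    have [_ Alx] := sx l sl.
    have [t [y yP]] := lin_span_bigcup
      (fun alpha (Qa : Q alpha) => subG (alpha, l) Qa) Alx.
    by exists (t, y).
  pose t := undup (flatten [seq (p l).1 | l <- s]).
  have tE l : l \in s -> x l = \sum_(alpha <- t) (p l).2 alpha.
    move=> sl; have [up _ _ p0 ->] := pP l sl; apply/esym/sum_extend => //.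
      exact: undup_uniq.
    move=> alpha pa; rewrite mem_undup; apply/flattenP.
    by exists (p l).1 => //; exact: map_f.
  have y0 : forall i, i \in [seq (alpha, l) | l <- s, alpha <- t] ->
      (p i.2).2 i.1 = 0.
    apply: indG.
    - apply: allpairs_uniq => //; first exact: undup_uniq.
      by move=> [l a] [m b] _ _ [-> ->].
    - move=> _ /allpairsP[[l alpha] [/= sl ta ->]] /=.
      have Qa : Q alpha.
        move: ta; rewrite mem_undup => /flattenP[_ /mapP[m sm ->] ma].
        by have [_ pQ _ _ _] := pP m sm; exact: pQ.
      by split=> //; have [_ _ pG _ _] := pP l sl; exact: pG.
    - rewrite big_allpairs_dep -[RHS]x0 big_seq [RHS]big_seq.
      by apply: eq_bigr => l sl; rewrite (tE l sl).
  move=> l sl; rewrite (tE l sl) big_seq big1 // => alpha ta.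
  by apply: (y0 (alpha, l)); apply/allpairsP; exists (l, alpha).
Qed.

(** * Homogeneous elements of the centroid *)

Section Centroid.
Context {K : fieldType} {Lambda : zmodType} {L : lieAlgType K}.
Context {A : Lambda -> set L}.
Hypothesis dsA : direct_sum [set: Lambda] A [set: L].

Lemma linear_eq_homogeneous (f g : L -> L) : linear f -> linear g ->
  (forall l x, A l x -> f x = g x) -> f = g.
Proof.
move=> lf lg fg; apply/funext => x; have : [set: L] x by [].
have [_ -> _] := dsA; apply: (lin_span_min (subspace_linear_eq lf lg)).
by move=> y [l _ /fg].
Qed.

Variables (Gamma : set Lambda) (chi : Lambda -> L -> L).
Hypothesis chiP : centroid_basis A Gamma chi.

Lemma centroid_chi mu : Gamma mu -> centroid (chi mu).
Proof.
move=> Gmu; have [_ -> _] := centroid_sum chiP; apply: sub_gen_smallest.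
by exists mu => //; exists 1 => //; rewrite scale1r.
Qed.

(** Write [f] as a sum of multiples [y nu] of the [chi nu].  For [x] of degree
    [l], both [f x] and the [y nu x] are homogeneous, of degrees [l + mu] and
    [l + nu]; independence of the [A k] kills every [y nu x] with
    [nu != mu]. *)
Lemma homogeneous_centroid mu (f : L -> L) : Gamma mu -> centroid f ->
  (forall l x, A l x -> A (l + mu) (f x)) -> exists c : K, f = c *: chi mu.
Proof.
move=> Gmu cf degf; have [lf _] := cf.
have subA l : subspace_pred (A l) by case: dsA => + _ _; exact.
have [subchi spanchi _] := centroid_sum chiP.
move: (cf); rewrite spanchi => /(lin_span_bigcup subchi).
move=> [s [y [us sG yl y0 fE]]].
have [c _ cE] := yl _ Gmu; exists c.
have lchi : linear (c *: chi mu).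
  by apply: linear_scale; have [] := centroid_chi Gmu.
apply: (linear_eq_homogeneous lf lchi) => l x Alx; rewrite cE.
(* [mu] need not be in the support [s], in which case [y mu] is 0. *)
pose t := undup (mu :: s).
have tG nu : nu \in t -> Gamma nu.
  by rewrite mem_undup inE => /orP[/eqP -> //|/sG].
have mut : mu \in t by rewrite mem_undup inE eqxx.
(* [z nu] is the component of degree [l + nu] of the relation
   [\sum_nu y nu x - f x = 0]. *)
pose z nu := y nu x - (if nu == mu then f x else 0).
have degK nu : l + nu - l = nu by rewrite addrC addKr.
have : z (l + mu - l) = 0; last first.
  by rewrite degK /z eqxx => /eqP; rewrite subr_eq0 => /eqP.
have [_ _ indA] := dsA.
apply: (indA [seq l + nu | nu <- t] (fun k => z (k - l))).
- by rewrite map_inj_uniq ?undup_uniq //; exact: addrI.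
- move=> _ /mapP[nu tnu ->]; split=> //; rewrite degK /z.
  have [b _ <-] := yl _ (tG _ tnu); apply: subspaceB => //.
    by apply: subspaceZ => //; apply: (centroid_degree chiP) => //; exact: tG.
  by case: eqP => [->|_]; [exact: degf | exact: subspace0].
- rewrite big_map.
  under eq_bigr => nu _ do rewrite degK.
  rewrite sumrB -big_mkcond -big_filter /= filter_pred1_uniq ?undup_uniq //.
  rewrite big_seq1 fE fct_sumE (@sum_extend _ _ _ s t) ?subrr ?undup_uniq //.
  + by move=> nu snu; rewrite mem_undup inE snu orbT.
  + by move=> nu /y0 ->.
- exact: map_f.
Qed.

End Centroid.

(** * Pullback of discrete subsets *)

(** A neighbourhood isolating [f x] in [Y] pulls back to one isolating [x]. *)
Lemma discrete_set_pullback (S T : topologicalType) (f : S -> T)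
    (X : set S) (Y : set T) :
  continuous f -> {in X &, injective f} -> f @` X `<=` Y ->
  discrete_set Y -> discrete_set X.
Proof.
move=> cf finj fXY dY; apply/seteqP; split; first exact: isolatedS.
move=> x Xx; have Yfx : Y (f x) by apply: fXY; exists x.
have [_ [U nU UY]] : isolated Y (f x) by rewrite dY.
split; first by rewrite inE.
exists (f @^-1` U); first exact: cf.
apply/seteqP; split=> [y [Uy Xy]|_ ->]; last first.
  by split=> //; have [+ _] : (U `&` Y) (f x) by rewrite UY.
apply: finj; rewrite ?inE //.
have : (U `&` Y) (f y) by split=> //; apply: fXY; exists y.
by rewrite UY.
Qed.

Lemma ptws_precomp_continuous (S T : eqType) (U : topologicalType)
    (b : S -> T) :
  continuous ((fun phi => phi \o b) : {ptws T -> U} -> {ptws S -> U}).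
Proof.
move=> phi.
(* The product topology is a supremum of initial topologies, so convergence is
   tested one evaluation at a time. *)
have FF : Filter ((fun f : {ptws T -> U} => f \o b) @ nbhs phi).
  exact: fmap_filter.
apply/cvg_sup => s; move: {FF} phi.
apply: (@continuous_comp_initial {ptws S -> U} {ptws T -> U} U (fun f => f s)).
exact: (@proj_continuous T (fun=> U) (b s)).
Qed.

(** * Transport along a pre-Chevalley involution *)

Section Transport.
Context {R : realType} {Lambda : zmodType} {L : lieAlgType R[i]}.
Context {A : Lambda -> set L} {tau : L -> L}.
Hypothesis tauP : pre_chevalley_involution tau A.

Local Notation bar := (bar tau).

Lemma tau_linear : linear tau.
Proof. by have [[]] := tauP. Qed.

Lemma tauK : involutive tau.
Proof.
by have [_ tau2 _ _] := tauP => x; rewrite -[RHS](congr1 (@^~ x) tau2).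
Qed.

Lemma tau_invE : tau_inv tau = tau.
Proof.
have [[_ tau_bij _] _ _ _] := tauP; apply/funext => x.
by rewrite -{1}[x]tauK tau_invK.
Qed.

Lemma barE d : bar d = tau \o d \o tau.
Proof. by rewrite /Defs.bar tau_invE. Qed.

Lemma bar_invE : bar_inv tau = bar.
Proof. by apply/funext => d; rewrite /bar_inv /Defs.bar tau_invE. Qed.

Lemma barK : involutive bar.
Proof. by move=> d; apply/funext => x; rewrite !barE /= !tauK. Qed.

Lemma bar_linear : linear bar.
Proof.
move=> a d d'; apply/funext => x; rewrite !barE.
change (tau (a *: d (tau x) + d' (tau x)) =
        a *: tau (d (tau x)) + tau (d' (tau x))).
exact: tau_linear.
Qed.

Lemma bar_comp f g : bar (f \o g) = bar f \o bar g.
Proof. by apply/funext => x; rewrite !barE /= tauK. Qed.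

Lemma bar_commutator f g : bar (commutator f g) = commutator (bar f) (bar g).
Proof.
rewrite /commutator -!bar_comp.
have barB u v : bar (u - v) = bar u - bar v.
  by rewrite addrC -scaleN1r bar_linear scaleN1r addrC.
exact: barB.
Qed.

Lemma linear_bar f : linear f -> linear (bar f).
Proof. by move=> lf a u v; rewrite barE /= tau_linear lf tau_linear. Qed.

Lemma tau_degree l x : A l x -> A (- l) (tau x).
Proof. by have [_ _ _ <-] := tauP => Alx; exists x. Qed.

Lemma bar_centroid f : centroid f -> centroid (bar f).
Proof.
have [[_ _ tauM] _ _ _] := tauP => -[lf fM]; split; first exact: linear_bar.
move=> x y; rewrite barE /= tauM; have [fMl fMr] := fM (tau x) (tau y).
by split; [rewrite fMl tauM tauK | rewrite fMr tauM tauK].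
Qed.

(** [tau x] has degree [- l] when [x] has degree [l], so [d] scales it by
    [- theta l]. *)
Lemma bar_degree_derivation (theta : {additive Lambda -> R[i]}) d :
  degree_derivation A theta d -> degree_derivation A (-1 \*o theta) (bar d).
Proof.
move=> [ld dA]; split=> [|l x Alx]; first exact: linear_bar.
rewrite barE /= (dA (- l)); last exact: tau_degree.
by rewrite (linear_atZ _ _ tau_linear) tauK /= raddfN mulN1r.
Qed.

Context {Gamma : set Lambda} {chi : Lambda -> L -> L}.
Hypothesis dsA : direct_sum [set: Lambda] A [set: L].
Hypothesis chiP : centroid_basis A Gamma chi.

Lemma GammaN mu : Gamma mu -> Gamma (- mu).
Proof.
have [G0 GB] := centroid_degrees chiP => Gmu.
by have := GB 0 mu; rewrite !inE sub0r; apply => //; rewrite inE in G0.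
Qed.

Lemma Gamma0 : Gamma 0.
Proof. by have [G0 _] := centroid_degrees chiP; rewrite inE in G0. Qed.

Lemma bar_chi mu : Gamma mu -> exists c : R[i], bar (chi mu) = c *: chi (- mu).
Proof.
move=> Gmu; apply: (homogeneous_centroid dsA chiP (GammaN Gmu)).
  exact/bar_centroid/(centroid_chi chiP).
move=> l x Alx; rewrite barE /= -[l]opprK -opprD; apply: tau_degree.
by apply: (centroid_degree chiP) => //; exact: tau_degree.
Qed.

(** Here bar (chi^mu partial_theta) is c chi^(- mu) partial_(- theta).  The
    scalar [c] is absorbed into the additive map [theta], since a component
    consists of exact products of chi^mu with degree derivations. *)
Lemma bar_SCDer_component mu f : Gamma mu ->
  SCDer_component A chi mu f -> SCDer_component A chi (- mu) (bar f).
Proof.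
move=> Gmu [theta [d [dP theta_mu ->]]]; have [c cE] := bar_chi Gmu.
have [ld dA] := bar_degree_derivation dP.
have [lchi _] := centroid_chi chiP (GammaN Gmu).
exists (c \*o (-1 \*o theta)), (c *: bar d); split.
- split; first exact: linear_scale.
  move=> l x Alx; rewrite /= -scalerA -dA //.
- by rewrite /= raddfN theta_mu oppr0 !mulr0.
- rewrite bar_comp cE; apply/funext => x /=; exact/esym/(linear_atZ _ _ lchi).
Qed.

Lemma bar_SCDer f : SCDer A Gamma chi f -> SCDer A Gamma chi (bar f).
Proof.
pose W := [set f | SCDer A Gamma chi (bar f)].
apply: (@lin_span_min _ _ _ W) => [|d [mu Gmu df]]; last first.
  apply: sub_gen_smallest; exists (- mu); first exact: GammaN.
  exact: bar_SCDer_component.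
have subS : subspace_pred (SCDer A Gamma chi) by exact: subspace_lin_span.
move: subS => /subspaceP[S0 SD]; apply/subspaceP; split.
  by rewrite /W /= (linear_at0 bar_linear).
by move=> a u v Wu Wv; rewrite /W /= bar_linear; exact: SD.
Qed.

(** The additive maps defining [bar d] are the opposites of those defining [d],
    so the choices on both sides are made from the same set of scalars. *)
Lemma ev_value_bar l d : ev_value A l (bar d) = ev_value A (- l) d.
Proof.
rewrite /ev_value; congr (xget 0 _); apply/seteqP; split=> c [theta dP ->].
  exists (-1 \*o theta); last by rewrite /= raddfN mulN1r opprK.
  by rewrite -[d]barK; exact: bar_degree_derivation.
exists (-1 \*o theta); first exact: bar_degree_derivation.
by rewrite /= raddfN mulN1r.
Qed.

Context {D : set (L -> L)}.
Local Notation Dtau := (D_tau tau D).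

Lemma D_tauP e : Dtau e <-> D (bar e).
Proof.
by split=> [[d Dd <-]|De]; [rewrite barK | exists (bar e); rewrite ?barK].
Qed.

(** One inclusion between components suffices, because [bar] is its own
    inverse. *)
Lemma component_D_tau mu e : Gamma mu ->
  component A chi Dtau mu e <-> component A chi D (- mu) (bar e).
Proof.
move=> Gmu; split=> -[/D_tauP De Se]; split => //.
- exact: bar_SCDer_component.
- rewrite -[mu]opprK -[e]barK; apply: bar_SCDer_component => //; exact: GammaN.
Qed.

Lemma permissible_D_tau :
  permissible A Gamma chi D -> permissible A Gamma chi Dtau.
Proof.
move=> [[DS subD DM] gradD injD discD].
have DbarP d : component A chi D 0 d -> component A chi Dtau 0 (bar d).
  move=> D0d; apply/component_D_tau; first exact: Gamma0.
  by rewrite oppr0 barK.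
pose b (d : component A chi D 0) : component A chi Dtau 0 :=
  SigSub (mem_set (DbarP _ (set_valP d))).
(* Precomposition with [bar] turns evaluations on D_tau into those on D. *)
pose pull : {ptws component A chi Dtau 0 -> R[i]^o} ->
            {ptws component A chi D 0 -> R[i]^o} := fun phi => phi \o b.
have pullE l :
    pull (@ev R Lambda L A chi Dtau l) = @ev R Lambda L A chi D (- l).
  by apply/funext => d; exact: ev_value_bar.
have pull_ev_inj l m :
    pull (@ev R Lambda L A chi Dtau l) = pull (@ev R Lambda L A chi Dtau m) ->
    l = m.
  by rewrite !pullE => /injD /oppr_inj.
split.
- split.
  + by move=> e /D_tauP /DS Se; rewrite -[e]barK; exact: bar_SCDer.
  + move: subD => /subspaceP[D0 DD]; apply/subspaceP; split.
      by apply/D_tauP; rewrite (linear_at0 bar_linear).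
    move=> a u v /D_tauP Du /D_tauP Dv; apply/D_tauP.
    by rewrite bar_linear; exact: DD.
  + move=> d d' /D_tauP Dd /D_tauP Dd'; apply/D_tauP.
    by rewrite bar_commutator; exact: DM.
- apply: (direct_sum_image bar_linear barK (@opprK Lambda) GammaN _ gradD).
  move=> mu Gmu; apply/seteqP.
  split=> [e /(component_D_tau _ Gmu) De|_ [d Dd <-]].
    by exists (bar e); rewrite ?barK.
  by apply/component_D_tau => //; rewrite barK.
- by move=> l m lm; apply: pull_ev_inj; rewrite lm.
- apply: (@discrete_set_pullback _ _ pull _ _ _ _ _ discD).
  + exact: ptws_precomp_continuous.
  + move=> _ _ /set_mem[l _ <-] /set_mem[m _ <-] /pull_ev_inj ->//.
  + by move=> _ [_ [l _ <-] <-]; rewrite pullE; exists (- l).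
Qed.

Lemma bar_dualE (phi : (L -> L) -> R[i]) e : bar_dual tau phi e = phi (bar e).
Proof. by rewrite /bar_dual bar_invE. Qed.

Lemma dual_component_bar mu phi :
  dual_component A Gamma chi D mu phi ->
  dual_component A Gamma chi Dtau (- mu) (bar_dual tau phi).
Proof.
move=> [lphi phi0]; split=> [a d d' /D_tauP Dd /D_tauP Dd'|nu d Gnu nu_mu].
  by rewrite !bar_dualE bar_linear lphi.
move=> /component_D_tau De; rewrite bar_dualE.
apply: (phi0 (- nu)); last exact: De.
  exact: GammaN.
by rewrite -[mu]opprK (inj_eq oppr_inj).
Qed.

Lemma graded_dual_bar phi :
  graded_dual A Gamma chi D phi ->
  graded_dual A Gamma chi Dtau (bar_dual tau phi).
Proof.
move=> [s [psi [psiP phiE]]].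
exists [seq - mu | mu <- s], (fun mu => bar_dual tau (psi (- mu))); split.
  move=> _ /mapP[mu /psiP[Gmu psi_mu] ->]; rewrite opprK; split.
    exact: GammaN.
  exact: dual_component_bar.
move=> e /D_tauP De; rewrite bar_dualE phiE // big_map !fct_sumE.
by apply: eq_bigr => mu _; rewrite opprK bar_dualE.
Qed.

Lemma kappa_tau_barE kappa e e' x :
  kappa_tau tau kappa e e' x = kappa (bar e) (bar e') (bar x).
Proof. by rewrite /kappa_tau bar_dualE bar_invE. Qed.

Lemma affine_cocycle_kappa_tau kappa :
  affine_cocycle A Gamma chi D kappa ->
  affine_cocycle A Gamma chi Dtau (kappa_tau tau kappa).
Proof.
have addE (f g : (L -> L) -> R[i]) x : (f + g) x = f x + g x by [].
case=> kval kl kr kalt kcyc kdeg kinv k0; split.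
- move=> d1 d2 /D_tauP D1 /D_tauP D2; rewrite /kappa_tau bar_invE.
  exact/graded_dual_bar/kval.
- move=> a d d' e /D_tauP Dd /D_tauP Dd' /D_tauP De x /D_tauP Dx.
  by rewrite !kappa_tau_barE bar_linear kl.
- move=> a d d' e /D_tauP Dd /D_tauP Dd' /D_tauP De x /D_tauP Dx.
  by rewrite !kappa_tau_barE bar_linear kr.
- by move=> d /D_tauP Dd x /D_tauP Dx; rewrite kappa_tau_barE kalt.
- move=> d1 d2 d3 /D_tauP D1 /D_tauP D2 /D_tauP D3 x /D_tauP Dx.
  rewrite !addE /dual_act !kappa_tau_barE !bar_commutator.
  exact: kcyc.
- move=> mu1 mu2 d1 d2 G1 G2.
  move=> /(component_D_tau _ G1) D1 /(component_D_tau _ G2) D2.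
  rewrite -opprD /kappa_tau bar_invE; apply: dual_component_bar.
  by have := kdeg _ _ _ _ (GammaN G1) (GammaN G2) D1 D2; rewrite !opprK.
- move=> d1 d2 d3 /D_tauP D1 /D_tauP D2 /D_tauP D3.
  by rewrite !kappa_tau_barE; exact: kinv.
- move=> d1 d2 /(component_D_tau _ Gamma0) D1 /D_tauP D2 x /D_tauP Dx.
  by rewrite kappa_tau_barE k0 //; rewrite oppr0 in D1.
Qed.

End Transport.

Theorem lemma3p2p1
  (R : realType) (Lambda : zmodType)
  (V : vectType R[i]) (Delta : seq V) (coroot : V -> {scalar V})
  (L : lieAlgType R[i]) (G : V -> Lambda -> set L)
  (Gamma : set Lambda) (chi : Lambda -> L -> L)
  (D : set (L -> L)) (kappa : (L -> L) -> (L -> L) -> (L -> L) -> R[i])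
  (tau : L -> L) :
  let A := ext_component Delta G in
  free_of_finite_rank Lambda ->
  irreducible_root_system Delta coroot ->
  is_lie_torus Delta coroot G ->
  centerless L ->
  centroid_basis A Gamma chi ->
  permissible A Gamma chi D ->
  affine_cocycle A Gamma chi D kappa ->
  pre_chevalley_involution tau A ->
  permissible A Gamma chi (D_tau tau D) /\
  affine_cocycle A Gamma chi (D_tau tau D) (kappa_tau tau kappa).
Proof.
move=> A _ _ torus _ chiP permD cocD tauP.
have dsA : direct_sum [set: Lambda] A [set: L].
  exact: direct_sum_ext_component (torus_sum torus).
split; first exact: permissible_D_tau.
exact: affine_cocycle_kappa_tau.
Qed.
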